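(* Let $P$ be the standard triadic Cantor distribution on $\mathbb R$ and let $X$ be a random variable with distribution $P$. Let $a_1:=E(X\mid X\in[0,\frac12])$ and $a_2:=E(X\mid X\in[\frac12,1])$. Then the set $\gamma:=\{a_1,a_2\}$ is not an optimal set of two-means for $P$.
   Context: For $j=1,2,3$ let $S_j:\mathbb R\to\mathbb R$, $S_j(x)=\frac15x+\frac25(j-1)$. The standard triadic Cantor distribution $P$ is the unique Borel probability measure on $\mathbb R$ with $P=\frac13\sum_{j=1}^3P\circ S_j^{-1}$. For a finite nonempty set $\alpha\subset\mathbb R$ the distortion error is $V(P;\alpha)=\int\min_{a\in\alpha}(x-a)^2\,dP(x)$. The $n$th quantization error is $V_n=V_n(P)=\inf\{V(P;\alpha):\alpha\subset\mathbb R,\ 1\leq\mathrm{card}(\alpha)\leq n\}$. An optimal set of $n$-means is a set $\alpha$ with at most $n$ points for which this infimum is attained. *)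

(* Defs.v *)
From HB Require Import structures.
From mathcomp Require Import all_boot all_order all_algebra finmap.
From mathcomp Require Import all_classical all_reals all_analysis.

Set Implicit Arguments.
Unset Strict Implicit.
Unset Printing Implicit Defensive.

Import Order.TTheory GRing.Theory Num.Theory.
Import numFieldNormedType.Exports.

Local Open Scope classical_set_scope.
Local Open Scope ring_scope.

Definition triadic_map (R : realType) (j : nat) (x : R) : R :=
  1 / 5 * x + 2 / 5 * (j%:R - 1).

(* Exactly one Borel probability measure satisfies this self-similarity
   equation, so the predicate characterizes the Cantor distribution. *)
Definition is_triadic_cantor (R : realType)
    (P : probability (measurableTypeR R) R) : Prop :=
  forall A : set (measurableTypeR R), measurable A ->
    P A = ((1 / 3)%:E * \sum_(1 <= j < 4) P (@triadic_map R j @^-1` A))%E.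

(* The unit [+oo] of the minimum plays no role when [alpha] is nonempty. *)
Definition distortion (R : realType) (P : probability (measurableTypeR R) R)
    (alpha : {fset R}) : \bar R :=
  (\int[P]_x \big[Order.min/+oo]_(a <- alpha) ((x - a) ^+ 2)%:E)%E.

Definition quantization_error (R : realType)
    (P : probability (measurableTypeR R) R) (n : nat) : \bar R :=
  ereal_inf [set distortion P alpha |
    alpha in [set alpha : {fset R} | (1 <= #|` alpha| <= n)%N]].

Definition optimal_set_of_means (R : realType)
    (P : probability (measurableTypeR R) R) (n : nat) (alpha : {fset R}) : Prop :=
  (1 <= #|` alpha| <= n)%N /\ distortion P alpha = quantization_error P n.

(* E(X | X \in A), conditioning on an event: E(X; X \in A) / Q(X \in A). *)
Definition cond_mean (d : measure_display) (T : measurableType d)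
    (R : realType) (Q : probability T R)
    (X : {RV Q >-> measurableTypeR R}) (A : set R) : R :=
  (\int[Q]_(w in X @^-1` A) X w) / fine (Q (X @^-1` A)).

(* Main.v *)
Require Import Defs.
From HB Require Import structures.
From mathcomp Require Import all_boot all_order all_algebra finmap.
From mathcomp Require Import all_classical all_reals all_analysis.
From mathcomp Require Import measurable_realfun.
From mathcomp Require Import ring lra.

Set Implicit Arguments.
Unset Strict Implicit.
Unset Printing Implicit Defensive.

Import Order.TTheory GRing.Theory Num.Theory.
Import numFieldNormedType.Exports.

Local Open Scope classical_set_scope.
Local Open Scope ring_scope.

(** The point 1/2 at which the conditional means a1 and a2 divide the line lies
    in the middle of the central piece S_2 [0, 1] of the Cantor set, and it is
    better to divide that piece unevenly, at a gap. Write J_w for the image of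
    [0, 1] under S_w. The set {9/50, 189/250} consists of the conditional means
    of P on J_1, J_21 (mass 4/9) and on J_22, J_23, J_3 (mass 5/9); its
    distortion is about 0.02919, whereas {a1, a2} = {3/14, 11/14} has distortion
    13/441, about 0.02948. So the infimum over two-point sets is strictly below
    the distortion of {a1, a2}.

    The integrals are computed from self-similarity. First, P is carried by
    [0, 1] ([cantor_support]), because the maps S_j bring points closer to that
    interval. Then E f = (1/3) sum_j E (f o S_j) for every measurable f bounded
    on [0, 1] ([mean_self_similar]). Applied to x, to x^2 and to affine
    functions truncated at 1/2, this yields linear equations whose solutions are
    the moments E X = 1/2, E X^2 = 13/36 and the half moments that give a1, a2
    ([cond_mean_halves]) and their distortion ([mean_loss_conditional]). Applied
    twice to the loss of {9/50, 189/250}, it leaves only squares of affine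
    functions ([mean_loss_better]). *)

(** * The support of the Cantor distribution *)

Lemma measurable_triadic_map (R : realType) (j : nat) :
  measurable_fun setT (@triadic_map R j : measurableTypeR R -> measurableTypeR R).
Proof.
apply: measurable_funD => //; exact: measurable_funM.
Qed.

(** The maps S_j bundled as random variables on the space (R, P), so that their
    laws under P are available as measures. *)
Definition triadic_rv (R : realType) (P : probability (measurableTypeR R) R)
    (j : nat) : {RV P >-> measurableTypeR R} :=
  HB.pack_for {mfun measurableTypeR R >-> measurableTypeR R}
    (@triadic_map R j : measurableTypeR R -> measurableTypeR R)
    (isMeasurableFun.Build _ _ (measurableTypeR R) (measurableTypeR R)
       (@triadic_map R j) (@measurable_triadic_map R j)).

Definition self_similar_measure (R : realType)
    (P : probability (measurableTypeR R) R) :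
    {measure set (measurableTypeR R) -> \bar R} :=
  mscale (1 / 3)%:nng (msum (fun j => distribution P (triadic_rv P j.+1)) 3).

Lemma cantor_self_similar (R : realType)
    (P : probability (measurableTypeR R) R) (hP : is_triadic_cantor P)
    (A : set (measurableTypeR R)) : measurable A ->
  P A = self_similar_measure P A.
Proof.
move=> mA; rewrite hP// /self_similar_measure /mscale /msum /=.
by rewrite big_add1 /= big_mkord.
Qed.

Lemma cantor_preimages (R : realType)
    (P : probability (measurableTypeR R) R) (hP : is_triadic_cantor P)
    (A : set (measurableTypeR R)) : measurable A ->
  P A = ((1 / 3)%:E * (P (@triadic_map R 1 @^-1` A)
     + (P (@triadic_map R 2 @^-1` A) + P (@triadic_map R 3 @^-1` A))))%E.
Proof.
move=> mA; rewrite hP//; congr (_ * _)%E.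
by rewrite big_ltn// big_ltn// big_nat1.
Qed.

Definition outside (R : realType) (r : R) : set (measurableTypeR R) :=
  ~` `[- r, 1 + r].

Lemma measurable_outside (R : realType) (r : R) : measurable (outside r).
Proof. by apply: measurableC; exact: measurable_itv. Qed.

(** Each S_j contracts distances to [0, 1] by the factor 5, because it maps
    [0, 1] into itself; so a point that S_j sends at distance more than r from
    [0, 1] was at distance more than 5 r. *)
Lemma cantor_outside_expand (R : realType)
    (P : probability (measurableTypeR R) R) (hP : is_triadic_cantor P) (r : R) :
  (P (outside r) <= P (outside (5 * r)))%E.
Proof.
have step j : (0 < j < 4)%N ->
    (P (@triadic_map R j @^-1` outside r) <= P (outside (5 * r)))%E.
  move=> j13; apply: le_measure; rewrite ?inE.
  - rewrite -[X in measurable X]setTI; apply: measurable_triadic_map => //.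
    exact: measurable_outside.
  - exact: measurable_outside.
  - move=> x /= outx inx; apply: outx; move: inx.
    rewrite /= /triadic_map !in_itv /=.
    by case: j j13 => [|[|[|[|j]]]]//= _ /andP[? ?]; apply/andP; split; lra.
rewrite cantor_preimages//; last exact: measurable_outside.
have finO : P (outside (5 * r)) \is a fin_num.
  by apply: fin_num_measure; exact: measurable_outside.
have -> : P (outside (5 * r)) = ((1 / 3)%:E *
    (P (outside (5 * r)) + (P (outside (5 * r)) + P (outside (5 * r)))))%E.
  by rewrite -(fineK finO) -!EFinD -EFinM; congr EFin; field.
apply: lee_wpmul2l; first by rewrite lee_fin; lra.
by apply: leeD; [exact: step|apply: leeD; exact: step].
Qed.

(** Iterating the expansion bounds this mass by the mass outside
    neighbourhoods of radius 5^n r, and these complements decrease to the empty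
    set. *)
Lemma cantor_outside0 (R : realType)
    (P : probability (measurableTypeR R) R) (hP : is_triadic_cantor P) (r : R) :
  0 < r -> P (outside r) = 0%E.
Proof.
move=> r0; apply/eqP; rewrite eq_le measure_ge0 andbT.
have expand n : (P (outside r) <= P (outside (5 ^+ n * r)))%E.
  elim: n => [|n ih]; first by rewrite expr0 mul1r.
  by rewrite exprS -mulrA; apply: le_trans ih _; exact: cantor_outside_expand.
have capE : \bigcap_n outside (5 ^+ n * r) = set0 :> set (measurableTypeR R).
  apply/seteqP; split=> // x /(_ (Num.truncn (`|x| / r)).+1 I); apply.
  have lt5 n : n%:R <= 5 ^+ n :> R by rewrite -natrX ler_nat; apply/ltnW/ltn_expl.
  have := truncnS_gt (`|x| / r); rewrite ltr_pdivrMr// => /ltW xr.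
  have {}xr : `|x| <= 5 ^+ (Num.truncn (`|x| / r)).+1 * r.
    by apply: le_trans xr _; rewrite ler_pM2r.
  move: xr; rewrite ler_norml /= in_itv /= => /andP[? ?].
  by apply/andP; split => //; lra.
have : P (outside (5 ^+ n * r)) @[n --> \oo] --> 0%E.
  rewrite -(measure0 P) -capE; apply: nonincreasing_cvg_mu.
  - by rewrite ltey_eq fin_num_measure//; exact: measurable_outside.
  - by move=> n; exact: measurable_outside.
  - by rewrite capE.
  - move=> m n mn; apply/subsetPset => x /= outx inx; apply: outx; move: inx.
    have : 5 ^+ m * r <= 5 ^+ n * r by rewrite ler_pM2r// ler_eXn2l//; lra.
    by rewrite /= !in_itv /= => ? /andP[? ?]; apply/andP; split; lra.
by apply: cvge_ge; near=> n; exact: expand.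
Unshelve. all: end_near. Qed.

Lemma unit_itv_limit (R : realType) (x : R) :
  (forall n, - n.+1%:R^-1 <= x <= 1 + n.+1%:R^-1) -> 0 <= x <= 1.
Proof.
move=> inn; apply/andP; split; rewrite leNgt; apply/negP.
- rewrite -oppr_gt0 => /ltr_add_invr[n]; rewrite add0r ltrNr.
  by case/andP: (inn n) => /le_lt_trans h _ /h; rewrite ltxx.
- move=> /ltr_add_invr[n]; rewrite ltNge.
  by case/andP: (inn n) => _ ->.
Qed.

(** Iterated expansion says nothing at radius 0, so the complement of [0, 1] is
    covered by the complements of the neighbourhoods of radius 1 / (n + 1). *)
Lemma cantor_support (R : realType)
    (P : probability (measurableTypeR R) R) (hP : is_triadic_cantor P) :
  P (~` `[0, 1]) = 0%E.
Proof.
apply: measure_negligible; first by apply: measurableC; exact: measurable_itv.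
apply: (@negligibleS _ _ _ _ (\bigcup_n outside n.+1%:R^-1)); last first.
  apply: negligible_bigcup => n; exists (outside n.+1%:R^-1); split => //.
  - exact: measurable_outside.
  - exact: cantor_outside0.
move=> x /= xI; apply: contrapT => notU; apply: xI.
rewrite /= in_itv /=; apply: unit_itv_limit => n.
by apply: contrapT => h; apply: notU; exists n.
Qed.

(** * Expectations and self-similarity *)

(** A class of integrands that is stable under every operation used below,
    including composition with the S_j. Boundedness is only required on [0, 1],
    so that polynomials qualify; measurability is global, since integrals are
    transported along maps defined on the whole line. *)
Definition tame (R : realType) (f : R -> R) : Prop :=
  measurable_fun setT f /\ exists K, forall x, 0 <= x <= 1 -> `|f x| <= K.

Lemma tame_cst (R : realType) (c : R) : tame (fun=> c).
Proof. by split; [exact: measurable_cst|exists `|c|]. Qed.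

Lemma tame_id (R : realType) : tame (@id R).
Proof.
split; first exact: measurable_id.
by exists 1 => x /andP[? ?]; rewrite ger0_norm.
Qed.

Lemma tame_add (R : realType) (f g : R -> R) :
  tame f -> tame g -> tame (fun x => f x + g x).
Proof.
move=> [mf [K hK]] [mg [L hL]]; split; first exact: measurable_funD.
exists (K + L) => x x01; apply: le_trans (ler_normD _ _) _.
by apply: lerD; [exact: hK|exact: hL].
Qed.

Lemma tame_mul (R : realType) (f g : R -> R) :
  tame f -> tame g -> tame (fun x => f x * g x).
Proof.
move=> [mf [K hK]] [mg [L hL]]; split; first exact: measurable_funM.
exists (K * L) => x x01; rewrite normrM.
by apply: ler_pM => //; [exact: hK|exact: hL].
Qed.

Lemma tame_if (R : realType) (c : R -> bool) (f g : R -> R) :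
  measurable_fun setT c -> tame f -> tame g ->
  tame (fun x => if c x then f x else g x).
Proof.
move=> mc [mf [K hK]] [mg [L hL]]; split; first exact: measurable_fun_ifT.
exists (Num.max K L) => x x01; rewrite le_max.
by case: ifP => _; rewrite ?hK ?hL ?orbT.
Qed.

Lemma tame_min (R : realType) (f g : R -> R) :
  tame f -> tame g -> tame (fun x => Num.min (f x) (g x)).
Proof.
move=> tf tg; apply: (@tame_if _ (fun x => f x < g x)) => //.
by case: tf tg => mf _ [mg _]; exact: measurable_fun_ltr.
Qed.

Lemma tame_affine (R : realType) (p q : R) : tame (fun x => p * x + q).
Proof. by apply: tame_add; [apply: tame_mul|]; do ?exact: tame_cst; exact: tame_id. Qed.

Lemma tame_sqr (R : realType) (f : R -> R) : tame f -> tame (fun x => f x ^+ 2).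
Proof. by move=> tf; exact: tame_mul. Qed.

Lemma tame_indic (R : realType) (A : set (measurableTypeR R)) : measurable A ->
  tame (\1_A : R -> R).
Proof.
move=> mA; split; first exact: measurable_indic.
by exists 1 => x _; rewrite indicE; case: (_ \in _); rewrite ?normr1 ?normr0.
Qed.

Lemma triadic_map_unit (R : realType) (j : nat) (x : R) :
  (0 < j < 4)%N -> 0 <= x <= 1 -> 0 <= @triadic_map R j x <= 1.
Proof.
move=> j13 /andP[x0 x1]; rewrite /triadic_map.
by case: j j13 => [|[|[|[|j]]]]//= _; apply/andP; split; lra.
Qed.

Lemma tame_triadic_map (R : realType) (j : nat) (f : R -> R) :
  (0 < j < 4)%N -> tame f -> tame (f \o @triadic_map R j).
Proof.
move=> j13 [mf [K hK]]; split.
  by apply: measurableT_comp => //; exact: measurable_triadic_map.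
by exists K => x x01; apply: hK; exact: triadic_map_unit.
Qed.

(** The expectation under P. Integrating over [0, 1] rather than the whole line
    lets integrands be compared and bounded on [0, 1] only. *)
Definition mean (R : realType) (P : probability (measurableTypeR R) R)
  (f : R -> R) : R := \int[P]_(x in `[0, 1]) f x.

Section mean_theory.
Context (R : realType) (P : probability (measurableTypeR R) R).
Implicit Types f g : R -> R.
Let I : set (measurableTypeR R) := `[0, 1].
Let mI : measurable I. Proof. exact: measurable_itv. Qed.

Lemma tame_integrable f : tame f -> P.-integrable I (EFin \o f).
Proof.
move=> [mf [K hK]]; apply: measurable_bounded_integrable => //.
- by rewrite ltey_eq fin_num_measure.
- exact: measurable_funTS.
- exists K; split; first exact: num_real.
  move=> M KM x x01; apply: le_trans (ltW KM).
  by apply: hK; move: x01; rewrite /I /= in_itv.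
Qed.

Lemma eq_mean f g : (forall x, 0 <= x <= 1 -> f x = g x) -> mean P f = mean P g.
Proof.
move=> fg; apply: eq_Rintegral => x; rewrite inE /= in_itv /=; exact: fg.
Qed.

Lemma meanD f g : tame f -> tame g ->
  mean P (fun x => f x + g x) = mean P f + mean P g.
Proof. by move=> tf tg; apply: RintegralD => //; exact: tame_integrable. Qed.

Lemma meanZ (c : R) f : tame f -> mean P (fun x => c * f x) = c * mean P f.
Proof. by move=> tf; apply: RintegralZl => //; exact: tame_integrable. Qed.

Lemma EFin_mean f : tame f -> (mean P f)%:E = (\int[P]_(x in I) (f x)%:E)%E.
Proof.
move=> tf; rewrite /mean /Rintegral fineK// integrable_fin_num//.
exact: tame_integrable.
Qed.

Context (hP : is_triadic_cantor P).

Lemma mean_cst (c : R) : mean P (fun=> c) = c.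
Proof.
have PI : P I = 1%E.
  rewrite -[X in P X]setCK probability_setC ?cantor_support ?sube0//.
  exact: measurableC.
by rewrite /mean Rintegral_cst// (congr1 fine PI) mulr1.
Qed.

Lemma integral_support (f : R -> \bar R) : measurable_fun setT f ->
  (forall x, 0 <= f x)%E -> (\int[P]_(x in I) f x = \int[P]_x f x)%E.
Proof.
move=> mf f0; rewrite [RHS](ge0_negligible_integral (N := ~` I))//.
- by rewrite setDE setTI setCK.
- exact: measurableC.
- exact: cantor_support.
Qed.

(** For a nonnegative integrand the integral over [0, 1] is the one over the
    whole line, and only the latter is compatible with push-forwards: the
    preimages of [0, 1] under the S_j are larger than [0, 1]. *)
Lemma mean_self_similar_ge0 f : tame f -> (forall x, 0 <= f x) ->
  mean P f = 1 / 3 * (mean P (f \o @triadic_map R 1)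
    + (mean P (f \o @triadic_map R 2) + mean P (f \o @triadic_map R 3))).
Proof.
move=> tf f0; have [mf _] := tf; apply: EFin_inj.
have mEf : measurable_fun setT (fun x => (f x)%:E) by exact/measurable_EFinP.
have Ef0 x : (0 <= (f x)%:E)%E by rewrite lee_fin.
rewrite EFinM !EFinD !EFin_mean//; do ?exact: tame_triadic_map.
have supp j : (\int[P]_(x in I) ((f \o @triadic_map R j) x)%:E
    = \int[distribution P (triadic_rv P j)]_x (f x)%:E)%E.
  rewrite ge0_integral_distribution// integral_support// => [|x].
    by apply: measurableT_comp mEf _; exact: measurable_triadic_map.
  exact: Ef0.
rewrite !supp integral_support//.
rewrite (eq_measure_integral (self_similar_measure P)); last first.
  by move=> A mA _; exact: cantor_self_similar.
have Ef0T (x : measurableTypeR R) : setT x -> (0 <= (f x)%:E)%E.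
  by move=> _; exact: Ef0.
pose nu : {measure set (measurableTypeR R) -> \bar R} :=
  msum (fun j => distribution P (triadic_rv P j.+1)) 3.
transitivity ((1 / 3)%:E * \int[nu]_x (f x)%:E)%E.
  exact: (@ge0_integral_mscale _ _ _ nu setT measurableT (1/3)%:nng _ mEf Ef0T).
rewrite /nu (ge0_integral_measure_sum _ measurableT Ef0T mEf).
by rewrite !big_ord_recl big_ord0 adde0.
Qed.

(** The integrated form of P = (1/3) sum_j P o S_j^-1. It is what makes every
    integral below computable: an integrand whose composites with the S_j are
    expressible through itself gives a linear equation for its mean. *)
Lemma mean_self_similar f : tame f ->
  mean P f = 1 / 3 * (mean P (f \o @triadic_map R 1)
    + (mean P (f \o @triadic_map R 2) + mean P (f \o @triadic_map R 3))).
Proof.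
move=> tf; have [mf [K hK]] := tf.
(* The absolute value makes the shifted function nonnegative off [0, 1] too,
   where K is no bound for f. *)
pose g x := `|f x + K|.
have tg : tame g.
  split; first by apply: measurableT_comp => //; exact: measurable_funD.
  exists (K + `|K|) => x x01; rewrite /g normr_id; apply: le_trans (ler_normD _ _) _.
  by rewrite lerD2r; exact: hK.
have shift h : tame h -> (forall x, 0 <= x <= 1 -> `|h x| <= K) ->
    mean P (fun x => `|h x + K|) = mean P h + K.
  move=> th hh; rewrite -[in RHS](mean_cst K) -meanD//; last exact: tame_cst.
  apply: eq_mean => x /hh; rewrite ler_norml => /andP[? _].
  by rewrite ger0_norm//; lra.
have bd j : (0 < j < 4)%N -> forall x, 0 <= x <= 1 -> `|(f \o @triadic_map R j) x| <= K.
  move=> j13 x x01; apply: hK; exact: triadic_map_unit.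
have := mean_self_similar_ge0 tg (fun x => normr_ge0 _).
rewrite /g /comp !shift//; do ?exact: tame_triadic_map; do ?exact: bd.
lra.
Qed.
End mean_theory.

(** * Moments, losses and conditional means *)

Section moments.
Context (R : realType) (P : probability (measurableTypeR R) R).
Context (hP : is_triadic_cantor P).

Lemma mean_affine_comb (f : R -> R) (p q : R) : tame f ->
  mean P (fun x => p * f x + q) = p * mean P f + q.
Proof.
move=> tf; rewrite meanD//; last exact: tame_cst.
  by rewrite meanZ// mean_cst.
by apply: tame_mul => //; exact: tame_cst.
Qed.

Lemma mean_id : mean P id = 1 / 2.
Proof.
have := mean_self_similar hP (@tame_id R).
by rewrite /comp /triadic_map !mean_affine_comb//; do ?exact: tame_id; lra.
Qed.

(** Kept in terms of the second moment, so that it can be fed into the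
    self-similarity equation that determines that moment. *)
Lemma mean_sqr_affine_of_second_moment (p q : R) :
  mean P (fun x => (p * x + q) ^+ 2) =
  p ^+ 2 * mean P (fun x => x ^+ 2) + (p * q + q ^+ 2).
Proof.
transitivity (mean P (fun x => p ^+ 2 * x ^+ 2 + (2 * p * q * x + q ^+ 2))).
  by apply: eq_mean => x _; ring.
have ti := @tame_id R; have ts := tame_sqr ti.
rewrite meanD; [|by apply: tame_mul => //; exact: tame_cst|exact: tame_affine].
by rewrite meanZ// mean_affine_comb// mean_id; field.
Qed.

Lemma mean_sqr : mean P (fun x => x ^+ 2) = 13 / 36.
Proof.
have := mean_self_similar hP (tame_sqr (@tame_id R)).
by rewrite /comp /triadic_map !mean_sqr_affine_of_second_moment; lra.
Qed.

Lemma mean_sqr_affine (p q : R) :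
  mean P (fun x => (p * x + q) ^+ 2) = 13 / 36 * p ^+ 2 + p * q + q ^+ 2.
Proof. by rewrite mean_sqr_affine_of_second_moment mean_sqr; ring. Qed.

(** The two conditioning intervals share the point 1/2. Leaving the value there
    free treats the cuts x <= 1/2 and x < 1/2, and hence both intervals, alike. *)
Definition half_cut (c : R -> bool) :=
  [/\ measurable_fun setT c, forall x, x < 1 / 2 -> c x
    & forall x, 1 / 2 < x -> ~~ c x].

(** The point 1/2 is fixed by S_2, whereas S_1 and S_3 send [0, 1] to either
    side of it: truncation at 1/2 reproduces itself under S_2, and is trivial
    under the other two maps. *)
Lemma mean_half_self_similar (c : R -> bool) (f : R -> R) : half_cut c -> tame f ->
  mean P (fun x => if c x then f x else 0) =
  1 / 3 * (mean P (f \o @triadic_map R 1) +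
           mean P (fun x => if c x then f (triadic_map 2 x) else 0)).
Proof.
move=> [mc clt cgt] tf.
rewrite mean_self_similar//; last by apply: tame_if => //; exact: tame_cst.
congr (_ * _); rewrite addrA -[RHS]addr0; congr (_ + _ + _).
- apply: eq_mean => x /andP[x0 x1] /=.
  by rewrite clt// /triadic_map; lra.
- apply: eq_mean => x _ /=; suff -> : c (triadic_map 2 x) = c x by [].
  have [xl|xl|->] := ltgtP x (1 / 2).
  + by rewrite !clt// /triadic_map; lra.
  + by rewrite (negbTE (cgt _ xl)) (negbTE (cgt _ _))// /triadic_map; lra.
  + by congr c; rewrite /triadic_map; field.
- rewrite -[RHS](mean_cst hP); apply: eq_mean => x /andP[x0 x1] /=.
  by rewrite (negbTE (cgt _ _))// /triadic_map; lra.
Qed.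

Lemma mean_half_cst (c : R -> bool) : half_cut c ->
  mean P (fun x => if c x then 1 else 0) = 1 / 2.
Proof.
move=> hc; have := @mean_half_self_similar _ (fun=> 1) hc (tame_cst 1).
by rewrite /comp mean_cst//; lra.
Qed.

Lemma mean_half_affine_of_first_moment (c : R -> bool) (p q : R) : half_cut c ->
  mean P (fun x => if c x then p * x + q else 0) =
  p * mean P (fun x => if c x then x else 0) + q / 2.
Proof.
move=> hc; have [mc _ _] := hc.
have t1 : tame (fun x => if c x then x else 0).
  by apply: tame_if; [|exact: tame_id|exact: tame_cst].
have t2 : tame (fun x => if c x then 1 else 0 : R).
  by apply: tame_if; [|exact: tame_cst|exact: tame_cst].
transitivity (mean P (fun x => p * (if c x then x else 0) + q * (if c x then 1 else 0))).
  by apply: eq_mean => x _; case: (c x); ring.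
rewrite meanD; [|by apply: tame_mul => //; exact: tame_cst..].
by rewrite !meanZ// mean_half_cst//; lra.
Qed.

Lemma mean_half_id (c : R -> bool) : half_cut c ->
  mean P (fun x => if c x then x else 0) = 3 / 28.
Proof.
move=> hc; have := mean_half_self_similar hc (@tame_id R).
rewrite /comp /triadic_map mean_half_affine_of_first_moment//.
rewrite mean_affine_comb ?mean_id; last exact: tame_id.
lra.
Qed.

Lemma mean_half_affine (c : R -> bool) (p q : R) : half_cut c ->
  mean P (fun x => if c x then p * x + q else 0) = 3 / 28 * p + q / 2.
Proof.
by move=> hc; rewrite mean_half_affine_of_first_moment// mean_half_id//; ring.
Qed.

Lemma half_cut_le : half_cut (fun x => x <= 1 / 2).
Proof.
split=> [|x /ltW//|x]; last by rewrite -ltNge.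
by apply: measurable_fun_ler; [exact: measurable_id|exact: measurable_cst].
Qed.

Lemma half_cut_lt : half_cut (fun x => x < 1 / 2).
Proof.
split=> [|//|x /ltW]; last by rewrite -leNgt.
by apply: measurable_fun_ltr; [exact: measurable_id|exact: measurable_cst].
Qed.

Definition two_point_loss (a b x : R) : R :=
  Num.min ((x - a) ^+ 2) ((x - b) ^+ 2).

Lemma tame_two_point_loss (a b : R) : tame (two_point_loss a b).
Proof.
by apply: tame_min; apply: tame_sqr; apply: tame_add;
  do ?exact: tame_cst; exact: tame_id.
Qed.

Lemma two_point_loss_l (a b x : R) : a <= b -> x *+ 2 <= a + b ->
  two_point_loss a b x = (x - a) ^+ 2.
Proof. by move=> ab xab; apply: min_l; rewrite mulr2n in xab; nra. Qed.

Lemma two_point_loss_r (a b x : R) : a <= b -> a + b <= x *+ 2 ->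
  two_point_loss a b x = (x - b) ^+ 2.
Proof. by move=> ab xab; apply: min_r; rewrite mulr2n in xab; nra. Qed.

(** For distinct points the infinite unit of the minimum disappears, so that
    the distortion becomes the mean of a real function. *)
Lemma distortion_fset2 (a b : R) : a != b ->
  distortion P [fset a; b]%fset = (mean P (two_point_loss a b))%:E.
Proof.
move=> ab; rewrite EFin_mean; last exact: tame_two_point_loss.
rewrite integral_support//; last 2 first.
- by apply/measurable_EFinP; case: (tame_two_point_loss a b).
- by move=> x; rewrite lee_fin le_min !sqr_ge0.
apply: eq_integral => x _.
rewrite big_fsetU1 ?inE//= big_seq_fset1.
by rewrite -EFin_min.
Qed.

(** The midpoint of 3/14 and 11/14 is 1/2, so the loss is the quadratic for
    11/14 plus a correction, affine because the squares cancel, on the left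
    half. *)
Lemma mean_loss_conditional : mean P (two_point_loss (3 / 14) (11 / 14)) = 13 / 441.
Proof.
transitivity (mean P (fun x => (1 * x + - (11 / 14)) ^+ 2 +
    if x <= 1 / 2 then 8 / 7 * x + - (4 / 7) else 0)).
  apply: eq_mean => x _; case: ifPn => [x2|]; last rewrite -ltNge => x2.
  - by rewrite two_point_loss_l; [field|lra|rewrite mulr2n; lra].
  - by rewrite two_point_loss_r; [field|lra|rewrite mulr2n; lra].
rewrite meanD; [|exact/tame_sqr/tame_affine|]; last first.
  apply: tame_if; [by case: half_cut_le|exact: tame_affine|exact: tame_cst].
by rewrite mean_sqr_affine (mean_half_affine _ _ half_cut_le); field.
Qed.

(** When an affine image of [0, 1] lies on one side of the midpoint of a and b,
    the loss restricted to it is a single square. *)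
Lemma mean_loss_left (a b p q : R) (h : R -> R) :
    (forall x, h x = p * x + q) -> a <= b -> 0 <= p -> (p + q) *+ 2 <= a + b ->
  mean P (two_point_loss a b \o h) =
    13 / 36 * p ^+ 2 + p * (q - a) + (q - a) ^+ 2.
Proof.
move=> hE ab p0; rewrite mulr2n => pq; rewrite -mean_sqr_affine.
apply: eq_mean => x /andP[x0 x1] /=.
rewrite hE two_point_loss_l ?addrA// mulr2n.
by have : p * x <= p by [rewrite ler_piMr|]; lra.
Qed.

Lemma mean_loss_right (a b p q : R) (h : R -> R) :
    (forall x, h x = p * x + q) -> a <= b -> 0 <= p -> a + b <= q *+ 2 ->
  mean P (two_point_loss a b \o h) =
    13 / 36 * p ^+ 2 + p * (q - b) + (q - b) ^+ 2.
Proof.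
move=> hE ab p0; rewrite mulr2n => pq; rewrite -mean_sqr_affine.
apply: eq_mean => x /andP[x0 x1] /=.
rewrite hE two_point_loss_r ?addrA// mulr2n.
by have : 0 <= p * x by [rewrite mulr_ge0|]; lra.
Qed.

(** The midpoint 117/250 falls in the gap between S_2 S_1 [0, 1], which ends at
    11/25, and S_2 S_2 [0, 1], which starts at 12/25. Hence splitting the middle
    piece once leaves only pieces on one side of the midpoint. *)
Lemma mean_loss_better : mean P (two_point_loss (9 / 50) (189 / 250)) < 13 / 441.
Proof.
set L := two_point_loss _ _; pose S := @triadic_map R.
have t : tame L by exact: tame_two_point_loss.
have m1 : mean P (L \o S 1) =
    13 / 36 * (1 / 5) ^+ 2 + 1 / 5 * (0 - 9 / 50) + (0 - 9 / 50) ^+ 2.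
  by apply: (@mean_loss_left _ _ (1 / 5) 0 (S 1)) => [x|||];
    rewrite /S /triadic_map; lra.
have m21 : mean P ((L \o S 2) \o S 1) =
    13 / 36 * (1 / 25) ^+ 2 + 1 / 25 * (2 / 5 - 9 / 50) + (2 / 5 - 9 / 50) ^+ 2.
  by apply: (@mean_loss_left _ _ (1 / 25) (2 / 5) (S 2 \o S 1)) => [x|||];
    rewrite /S /triadic_map /=; lra.
have m22 : mean P ((L \o S 2) \o S 2) =
    13 / 36 * (1 / 25) ^+ 2 + 1 / 25 * (12 / 25 - 189 / 250) +
    (12 / 25 - 189 / 250) ^+ 2.
  by apply: (@mean_loss_right _ _ (1 / 25) (12 / 25) (S 2 \o S 2)) => [x|||];
    rewrite /S /triadic_map /=; lra.
have m23 : mean P ((L \o S 2) \o S 3) =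
    13 / 36 * (1 / 25) ^+ 2 + 1 / 25 * (14 / 25 - 189 / 250) +
    (14 / 25 - 189 / 250) ^+ 2.
  by apply: (@mean_loss_right _ _ (1 / 25) (14 / 25) (S 2 \o S 3)) => [x|||];
    rewrite /S /triadic_map /=; lra.
have m3 : mean P (L \o S 3) =
    13 / 36 * (1 / 5) ^+ 2 + 1 / 5 * (4 / 5 - 189 / 250) + (4 / 5 - 189 / 250) ^+ 2.
  by apply: (@mean_loss_right _ _ (1 / 5) (4 / 5) (S 3)) => [x|||];
    rewrite /S /triadic_map; lra.
have t2 : tame (L \o S 2) by exact: tame_triadic_map.
by rewrite (mean_self_similar hP t) (mean_self_similar hP t2) m1 m21 m22 m23 m3; lra.
Qed.

Lemma mean_indic (A : set (measurableTypeR R)) : measurable A ->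
  mean P \1_A = fine (P A).
Proof.
move=> mA; rewrite /mean /Rintegral.
rewrite integral_support//; last by apply/measurable_EFinP; exact: measurable_indic.
by rewrite integral_indic// setIT.
Qed.

(** A conditional mean of X depends on the law of X alone. Since A lies in
    [0, 1] the integrand is nonnegative, so that its integral can be transported
    along X and identified with an integral over the whole line. *)
Lemma cond_mean_cantor (d : measure_display) (T : measurableType d)
    (Q : probability T R) (X : {RV Q >-> measurableTypeR R})
    (hX : forall A : set (measurableTypeR R), measurable A ->
       distribution Q X A = P A)
    (A : set (measurableTypeR R)) : measurable A -> A `<=` `[0, 1] ->
  cond_mean X A = mean P (fun x => x * \1_A x) / mean P \1_A.
Proof.
move=> mA A01; rewrite /cond_mean mean_indic// -hX//; congr (_ / _).
have tf : tame (fun x => x * \1_A x).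
  by apply: tame_mul; [exact: tame_id|exact: tame_indic].
have mEf : measurable_fun setT (fun x : R => (x * \1_A x)%:E).
  by apply/measurable_EFinP; case: tf.
have f0 (x : R) : (0 <= (x * \1_A x)%:E)%E.
  rewrite lee_fin indicE; case: (boolP (x \in A)) => [|_]; last by rewrite mulr0.
  by rewrite inE => /A01; rewrite /= in_itv /= => /andP[? _]; rewrite mulr1.
have QE : (\int[Q]_(w in X @^-1` A) (X w)%:E =
    (mean P (fun x => x * \1_A x))%:E)%E.
  rewrite integral_mkcond EFin_mean// integral_support//.
  transitivity (\int[distribution Q X]_x (x * \1_A x)%:E)%E.
    rewrite ge0_integral_distribution//; apply: eq_integral => w _ /=.
    rewrite patchE indicE; have -> : (w \in X @^-1` A) = (X w \in A).
      by apply/idP/idP; rewrite !inE.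
    by case: (X w \in A); rewrite ?mulr1 ?mulr0.
  by apply: eq_measure_integral => B mB _; exact: hX.
by rewrite /Rintegral QE.
Qed.

Lemma cond_mean_halves (d : measure_display) (T : measurableType d)
    (Q : probability T R) (X : {RV Q >-> measurableTypeR R})
    (hX : forall A : set (measurableTypeR R), measurable A ->
       distribution Q X A = P A) :
  cond_mean X `[0, 1 / 2] = 3 / 14 /\ cond_mean X `[1 / 2, 1] = 11 / 14.
Proof.
have hl := half_cut_le; have hr := half_cut_lt.
split; rewrite cond_mean_cantor//.
- have -> : mean P (fun x => x * \1_`[0, 1 / 2] x) = 3 / 28.
    rewrite -(mean_half_id hl); apply: eq_mean => x /andP[x0 x1].
    by rewrite indicE mem_setE in_itv /= x0 /=; case: ifP; rewrite ?mulr1 ?mulr0.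
  have -> : mean P \1_`[0, 1 / 2] = 1 / 2.
    apply: (etrans _ (mean_half_cst hl)); apply: eq_mean => x /andP[x0 x1].
    by rewrite indicE mem_setE in_itv /= x0 /=; case: ifP.
  by field.
- by move=> x /=; rewrite !in_itv /= => /andP[-> x1]; lra.
- have -> : mean P (fun x => x * \1_`[1 / 2, 1] x) = 11 / 28.
    transitivity (mean P (fun x => (1 * x + 0) + if x < 1 / 2 then (- 1) * x + 0 else 0)).
      apply: eq_mean => x /andP[x0 x1].
      rewrite indicE mem_setE in_itv /= x1 andbT leNgt.
      by case: (x < 1 / 2) => /=; rewrite ?mulr1n ?mulr0n; ring.
    rewrite meanD; [|exact: tame_affine|]; last first.
      by apply: tame_if; [case: hr|exact: tame_affine|exact: tame_cst].
    rewrite (mean_half_affine _ _ hr) mean_affine_comb ?mean_id; last exact: tame_id.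
    by field.
  have -> : mean P \1_`[1 / 2, 1] = 1 / 2.
    transitivity (mean P (fun x => 1 + if x < 1 / 2 then 0 * x + (- 1) else 0)).
      apply: eq_mean => x /andP[x0 x1].
      rewrite indicE mem_setE in_itv /= x1 andbT leNgt.
      by case: (x < 1 / 2) => /=; rewrite ?mulr1n ?mulr0n; ring.
    rewrite meanD; [|exact: tame_cst|]; last first.
      by apply: tame_if; [case: hr|exact: tame_affine|exact: tame_cst].
    by rewrite (mean_half_affine _ _ hr) mean_cst//; field.
  by field.
- by move=> x /=; rewrite !in_itv /= => /andP[x0 ->]; lra.
Qed.

End moments.

Theorem proposition2p6 (R : realType) (P : probability (measurableTypeR R) R)
    (hP : is_triadic_cantor P)
    (d : measure_display) (T : measurableType d) (Q : probability T R)
    (X : {RV Q >-> measurableTypeR R})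
    (hX : forall A : set (measurableTypeR R), measurable A ->
       distribution Q X A = P A)
    (a1 a2 : R)
    (ha1 : a1 = cond_mean X `[0, 1 / 2])
    (ha2 : a2 = cond_mean X `[1 / 2, 1]) :
  ~ optimal_set_of_means P 2 [fset a1; a2]%fset.
Proof.
have [m1 m2] := cond_mean_halves hP hX.
rewrite ha1 ha2 m1 m2 => -[_ opt].
(* The conditional means of P on the pieces J_1, J_21 and on J_22, J_23, J_3,
   where J_w is the image of [0, 1] under S_w. *)
pose beta : {fset R} := [fset 9 / 50; 189 / 250]%fset.
have : (quantization_error P 2 <= distortion P beta)%E.
  by apply: ereal_inf_lbound; exists beta => //=; rewrite cardfs2; case: (_ == _).
rewrite -opt !distortion_fset2//; [|by apply/eqP; lra..].
by rewrite lee_fin mean_loss_conditional// leNgt mean_loss_better.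
Qed.
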